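(* Let $n\ge1$, let $G=\mathrm{PSL}(2,2^n)$ act on $X=\mathrm{GF}(2^n)\cup\{\infty\}$. If $B$ is a $13$-subset of $X$ with $11\mid |G_B|$, then $|G_B|=22$. Moreover, \[m_{78}=\begin{cases}1 & \text{if } n\equiv 0\pmod{10},\\ 0 & \text{if } n\not\equiv 0\pmod{10}.\end{cases}\]
   Context: $\mathrm{PSL}(2,2^n)$ is the group of all maps $X\to X$, $x\mapsto\frac{ax+b}{cx+d}$ with $a,b,c,d\in\mathrm{GF}(2^n)$, $ad-bc\neq0$ (usual conventions for $\infty$). For a $13$-subset $B$ of $X$, $G_B=\{g\in G: g(B)=B\}$ and $G(B)=\{g(B):g\in G\}$. Each orbit $G(B)$ is a simple $3$-$(2^n+1,13,\lambda_B)$ design (every $3$-subset of $X$ lies in exactly $\lambda_B$ members of $G(B)$), with $\lambda_B=1716/|G_B|$. $m_\lambda$ denotes the number of $G$-orbits $G(B)$ of $13$-subsets with $\lambda_B=\lambda$; so $m_{78}$ counts the orbits with $|G_B|=22$. *)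

(* Defs.v *)
From HB Require Import structures.
From mathcomp Require Import all_boot all_order all_algebra all_fingroup.
From mathcomp Require Import ring.

Set Implicit Arguments.
Unset Strict Implicit.
Unset Printing Implicit Defensive.

Import GRing.Theory.
Local Open Scope ring_scope.

(* The projective line X = F \cup {oo} is [option F], with [None] as oo. *)
Section Mobius.
Variable F : finFieldType.
Implicit Types (a b c d : F) (x : option F).

Definition mobius a b c d x : option F :=
  match x with
  | Some z => if c * z + d == 0 then None else Some ((a * z + b) / (c * z + d))
  | None => if c == 0 then None else Some (a / c)
  end.

Lemma mobius_comp a b c d a' b' c' d' x :
  a * d - b * c != 0 -> a' * d' - b' * c' != 0 ->
  mobius a' b' c' d' (mobius a b c d x) =
  mobius (a' * a + b' * c) (a' * b + b' * d)
         (c' * a + d' * c) (c' * b + d' * d) x.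
Proof.
move=> D D'; have key (u v : F) : (u != 0) || (v != 0) ->
    mobius a' b' c' d' (if v == 0 then None else Some (u / v)) =
    if c' * u + d' * v == 0 then None
    else Some ((a' * u + b' * v) / (c' * u + d' * v)).
  case: (eqVneq v) => [->|v0] /=.
    rewrite orbF => u0; rewrite !mulr0 !addr0 mulf_eq0 (negPf u0) orbF.
    by case: eqVneq => // c0; rewrite -mulf_div divff // mulr1.
  have -> : c' * (u / v) + d' = (c' * u + d' * v) / v by field.
  rewrite mulf_eq0 invr_eq0 (negPf v0) orbF => _.
  by case: eqVneq => // w0; congr Some; field; rewrite v0 w0.
case: x => [z|] /=.
  rewrite key; last first.
    apply: contraNT D; rewrite negb_or !negbK => /andP[/eqP u0 /eqP v0].
    have [c0|c0] := eqVneq c 0.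
      have d0 : d = 0 by rewrite -v0 c0 mul0r add0r.
      by rewrite c0 d0 !mulr0 subrr.
    rewrite -(inj_eq (mulfI c0)) mulr0; apply/eqP.
    have -> : c * (a * d - b * c) =
      c * (a * (c * z + d) - c * (a * z + b)) by ring.
    by rewrite u0 v0 !mulr0 subrr mulr0.
  have -> : (c' * a + d' * c) * z + (c' * b + d' * d) =
            c' * (a * z + b) + d' * (c * z + d) by ring.
  by have -> : (a' * a + b' * c) * z + (a' * b + b' * d) =
            a' * (a * z + b) + b' * (c * z + d) by ring.
rewrite key //; apply: contraNT D.
rewrite negb_or !negbK => /andP[/eqP-> /eqP->].
by rewrite mul0r mulr0 subrr.
Qed.

Lemma mobius_scalar a x : a != 0 -> mobius a 0 0 a x = x.
Proof.
move=> a0; case: x => [z|] /=; last by rewrite eqxx.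
by rewrite mul0r add0r (negPf a0) addr0 mulrAC divff // mul1r.
Qed.

Lemma mobius_inj a b c d : a * d - b * c != 0 -> injective (mobius a b c d).
Proof.
move=> D; apply: (can_inj (g := mobius d (- b) (- c) a)) => x.
rewrite mobius_comp //; last by rewrite mulrNN [d * a]mulrC.
have -> : d * a + - b * c = a * d - b * c by ring.
have -> : d * b + - b * d = 0 by ring.
have -> : - c * a + a * c = 0 by ring.
have -> : - c * b + a * d = a * d - b * c by ring.
exact: mobius_scalar.
Qed.

(* For |F| = 2^n every nonzero determinant is a square, so requiring only
   ad - bc <> 0 yields PSL(2,F) (= PGL(2,F)). Over a general finite field this
   set is PGL(2,F). *)
Definition mobius_set : {set {perm option F}} :=
  [set p : {perm option F} | [exists a, exists b, exists c, exists d,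
     (a * d - b * c != 0) && [forall x, p x == mobius a b c d x]]].

Lemma mobius_setP (p : {perm option F}) :
  reflect (exists a b c d, a * d - b * c != 0 /\ p =1 mobius a b c d)
          (p \in mobius_set).
Proof.
rewrite inE; apply: (iffP idP).
  move=> /existsP[a /existsP[b /existsP[c /existsP[d /andP[D /forallP h]]]]].
  by exists a, b, c, d; split=> // x; apply/eqP.
move=> [a [b [c [d [D h]]]]].
apply/existsP; exists a; apply/existsP; exists b; apply/existsP; exists c.
apply/existsP; exists d; rewrite D; apply/forallP => x; exact/eqP.
Qed.

(* Every fractional linear map with nonzero determinant does occur. *)
Lemma mem_mobius_set a b c d (D : a * d - b * c != 0) :
  perm (mobius_inj D) \in mobius_set.
Proof. by apply/mobius_setP; exists a, b, c, d; split=> // x; rewrite permE. Qed.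

Lemma group_set_mobius : group_set mobius_set.
Proof.
apply/group_setP; split.
  apply/mobius_setP; exists 1, 0, 0, 1; split.
    by rewrite mulr1 mulr0 subr0 oner_eq0.
  by move=> x; rewrite perm1 mobius_scalar ?oner_eq0.
move=> p q /mobius_setP[a [b [c [d [D hp]]]]].
move=> /mobius_setP[a' [b' [c' [d' [D' hq]]]]]; apply/mobius_setP.
exists (a' * a + b' * c), (a' * b + b' * d),
       (c' * a + d' * c), (c' * b + d' * d); split; last first.
  by move=> x; rewrite permM hp hq mobius_comp.
have -> : (a' * a + b' * c) * (c' * b + d' * d) -
          (a' * b + b' * d) * (c' * a + d' * c) =
          (a' * d' - b' * c') * (a * d - b * c) by ring.
by rewrite mulf_neq0.
Qed.

Canonical mobius_group := Group group_set_mobius.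

End Mobius.

Definition is_design (X : finType) (t k lambda : nat) (D : {set {set X}}) : bool :=
  [forall (A | A \in D), #|A| == k] &&
  [forall (T : {set X} | #|T| == t),
     #|[set A in D | T \subset A]| == lambda].

(* [('P^* )%act] is the action of permutations on subsets, B |-> g(B). *)
Definition set_stabiliser (X : finType) (G : {group {perm X}}) (B : {set X}) :
    {group {perm X}} :=
  'C_G[B | ('P^*)%act]%G.

Definition set_orbit (X : finType) (G : {group {perm X}}) (B : {set X}) :
    {set {set X}} :=
  orbit ('P^*)%act G B.

Definition num_design_orbits (X : finType) (G : {group {perm X}})
    (t k lambda : nat) : nat :=
  #|[set O in [set set_orbit G B | B : {set X} & #|B| == k] |
      is_design t k lambda O]|.

(* Main.v *)
Require Import Defs.
From mathcomp Require Import all_boot all_order all_algebra all_fingroup.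
From mathcomp Require Import all_solvable all_field ring.

(** Write q = 2^n and G for the group of fractional linear maps over F.

    G is sharply 3-transitive on the projective line, so the elements g with
    T contained in g(B), for a fixed 3-subset T, correspond to the ordered
    triples of distinct points of B ([card_sharply_transitive]).  Sorting them
    by the value of g(B) shows that lambda * |G_B| = 13 * 12 * 11 = 1716
    ([orbit_is_design]); thus lambda = 78 means |G_B| = 22, and only the blocks
    with 11 dividing |G_B| matter.

    For such a block B, take g of order 11 in G_B.  Its cycles have length 1
    or 11 and |B| = 13 is 2 modulo 11, so g fixes at least two points of B.
    Moving two of them to oo and 0, and a third point of B to 1, turns g into a scaling by
    a primitive 11th root of unity a; then B becomes {oo, 0} together with the
    powers of a, which is the set mu of all 11th roots of unity
    ([prime_stabiliser_base_block]).  Hence there is at most one orbit, and it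
    exists exactly when F has a primitive 11th root of unity, that is when 11
    divides q - 1, which means that 10 divides n, since 2 has order 10 modulo
    11 ([primitive_root11_iff]).

    It remains to see that H, the stabiliser of the block {oo, 0} + mu, has
    order exactly 22 ([card_set_stabiliser_base_block11]).  It contains the
    scalings by mu and the inversion z |-> 1/z, and the scalings by mu are all
    its elements that fix both oo and 0; so it suffices that the orbit of oo
    under H is {oo, 0}.  Otherwise the orbit would be the whole block, of odd
    size 13, and as |H| is even H would contain an involution fixing oo.  In
    characteristic 2 this is a translation z |-> z + b, with b in mu.  Applied
    to b * z for z in mu \ {1}, it shows that 1 + z is again an 11th root of
    unity, which a computation with twelfth powers rules out
    ([unity_root11_succ], [base_block11_no_involution]). *)

Set Implicit Arguments.
Unset Strict Implicit.
Unset Printing Implicit Defensive.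

(** * Orbits and stabilisers of subsets *)

Section SharplyTransitive.
Variables (X : finType) (G : {group {perm X}}).
Implicit Types (B T : {set X}) (g : {perm X}).

Lemma mem_set_stabiliser B g :
  g \in G -> {in B, forall x, g x \in B} -> g \in set_stabiliser G B.
Proof.
move=> gG gB; rewrite inE gG; apply/astab1P/eqP.
rewrite eqEcard card_setact leqnn andbT.
by apply/subsetP=> _ /imsetP[x xB ->]; apply: gB.
Qed.

Lemma set_stabiliser_mem B g x :
  g \in set_stabiliser G B -> x \in B -> g x \in B.
Proof.
by move=> /setIP[_ /astab1P gB] xB; rewrite -gB -/(aperm x g) mem_setact.
Qed.

Lemma set_stabiliser_acts B : [acts set_stabiliser G B, on B | 'P].
Proof. by rewrite -astab1_set subsetIr. Qed.

(** The fibre of g |-> g(B) over a member of the orbit is a coset of the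
    stabiliser of B. *)
Lemma card_orbit_containing B T :
  #|[set A in set_orbit G B | T \subset A]| * #|set_stabiliser G B| =
  #|[set g in G | T \subset ('P^* )%act B g]|.
Proof.
rewrite -[RHS]sum1_card.
rewrite (partition_big (fun g => ('P^* )%act B g)
  (mem [set A in set_orbit G B | T \subset A])) /=; last first.
  by move=> g; rewrite !inE => /andP[gG ->]; rewrite mem_orbit.
rewrite -sum_nat_const; apply: eq_bigr => A.
rewrite inE => /andP[/imsetP[h hG ->] TA].
rewrite sum1dep_card -(card_rcoset _ h).
rewrite -(amove_act ('P^* )%act B (subsetT G) hG).
apply: eq_card => g; rewrite !inE.
by case: eqP => [-> | _]; rewrite ?TA !(andbT, andbF).
Qed.

(** The tuple t lies in g(B) iff its preimage under g is a tuple of distinct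
    points of B, and sharp k-transitivity makes the preimage determine g and
    take every value. *)
Lemma card_sharply_transitive k (B : {set X}) (t : k.-tuple X) :
    [transitive^k G, on setT | 'P] ->
    {in G, forall g, n_act 'P t g = t -> g = 1%g} -> uniq t ->
  #|[set g in G | [set x in t] \subset ('P^* )%act B g]| = #|B| ^_ k.
Proof.
move=> tr fr ut; rewrite -(card_uniq_tuples k (mem B)).
have inj : {in [set g in G | [set x in t] \subset ('P^* )%act B g] &,
    injective (fun g => n_act 'P t g^-1)}.
  move=> g h; rewrite !inE => /andP[gG _] /andP[hG _] /= e.
  apply/(mulgI g^-1%g); rewrite mulVg; symmetry.
  apply: fr; rewrite ?groupM ?groupV // (actM ('P * k)%act) /= e.
  exact: (actKV ('P * k)%act).
rewrite -(card_in_imset inj); apply: eq_card => u; rewrite !inE.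
apply/imsetP/idP.
  case=> g; rewrite inE => /andP[gG /subsetP tB] ->.
  rewrite map_inj_uniq ?ut ?andbT; last exact: perm_inj.
  apply/allP=> _ /mapP[x xt ->].
  have /imsetP[y yB ->] : x \in ('P^* )%act B g by apply: tB; rewrite inE.
  by rewrite (actK 'P%act).
case/andP=> /allP uB uu.
have td (v : k.-tuple X) : uniq v -> v \in k.-dtuple([set: X]).
  by move=> uv; rewrite inE uv; apply/subsetP.
have [g gG e] := atransP2 tr (td _ uu) (td _ ut).
exists g; last first.
  by rewrite e -[LHS](actK ('P * k)%act g).
rewrite inE gG; apply/subsetP=> x; rewrite inE e => /mapP[y yu ->].
by rewrite mem_setact //; apply: uB.
Qed.

End SharplyTransitive.

Import GRing.Theory.
Local Open Scope ring_scope.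

(** * Sharp 3-transitivity on the projective line *)

Section MobiusGroup.
Variable F : finFieldType.
Implicit Types (a b c d z : F) (x y w : option F) (p : {perm option F}).
Local Notation G := (mobius_group F).

Lemma mobius_group_exists a b c d : a * d - b * c != 0 ->
  exists2 p, p \in G & p =1 mobius a b c d.
Proof.
move=> D; exists (perm (mobius_inj D)); first exact: mem_mobius_set.
by move=> x; rewrite permE.
Qed.

Lemma mobius_affineE a b z : mobius a b 0 1 (Some z) = Some (a * z + b).
Proof. by rewrite /= mul0r add0r oner_eq0 divr1. Qed.

Lemma affine_exists a b : a != 0 ->
  exists p, [/\ p \in G, p None = None &
                forall z, p (Some z) = Some (a * z + b)].
Proof.
move=> a0; have D : a * 1 - b * 0 != 0 by rewrite mulr1 mulr0 subr0.
have [p pG pE] := mobius_group_exists D; exists p; split=> // [|z].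
  by rewrite pE /= eqxx.
by rewrite pE mobius_affineE.
Qed.

Lemma inversion_exists :
  exists p, [/\ p \in G, p None = Some 0, p (Some 0) = None &
                forall z, z != 0 -> p (Some z) = Some z^-1].
Proof.
have D : 0 * 0 - (- 1) * (- 1) != 0 :> F.
  by rewrite mul0r mulrNN mulr1 sub0r oppr_eq0 oner_eq0.
have [p pG pE] := mobius_group_exists D; exists p; split=> // [||z z0].
- by rewrite pE /= oppr_eq0 oner_eq0 mul0r.
- by rewrite pE /= mulr0 addr0 eqxx.
rewrite pE /= mul0r add0r addr0 mulN1r oppr_eq0 (negPf z0).
by rewrite invrN mulrNN mul1r.
Qed.

Lemma fix_infinity_affine p : p \in G -> p None = None ->
  exists a b, a != 0 /\ forall z, p (Some z) = Some (a * z + b).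
Proof.
move=> /mobius_setP[a [b [c [d [D pE]]]]].
rewrite pE /=; case: (eqVneq c 0) => // c0 _.
move: D; rewrite c0 mulr0 subr0 mulf_eq0 negb_or => /andP[a0 d0].
exists (a / d), (b / d); split; first by rewrite mulf_neq0 ?invr_eq0.
by move=> z; rewrite pE /= c0 mul0r add0r (negPf d0) mulrDl mulrAC.
Qed.

Lemma fix_infinity_zero_scaling p :
    p \in G -> p None = None -> p (Some 0) = Some 0 ->
  exists2 a, a != 0 & forall z, p (Some z) = Some (a * z).
Proof.
move=> pG pN p0; have [a [b [a0 pE]]] := fix_infinity_affine pG pN.
move: p0; rewrite pE mulr0 add0r => -[b0]; exists a => // z.
by rewrite pE b0 addr0.
Qed.

Lemma mobius_fix3 p : p \in G -> p None = None -> p (Some 0) = Some 0 ->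
  p (Some 1) = Some 1 -> p = 1%g.
Proof.
move=> pG pN p0; have [a _ pE] := fix_infinity_zero_scaling pG pN p0.
rewrite pE mulr1 => -[a1]; apply/permP => -[z|]; rewrite perm1 // pE a1.
by rewrite mul1r.
Qed.

(** A translation followed by an inversion sends x to oo; an affine map then
    adjusts the images of y and w without moving oo. *)
Lemma mobius_to_base x y w : uniq [:: x; y; w] ->
  exists p, [/\ p \in G, p x = None, p y = Some 0 & p w = Some 1].
Proof.
have [q qG qx] : exists2 q, q \in G & q x = None.
  case: x => [u|]; last by exists 1%g; rewrite ?group1 ?perm1.
  have [s [sG _ s0 _]] := inversion_exists.
  have [t [tG _ tE]] := affine_exists (- u) (oner_neq0 F).
  exists (t * s)%g; first by rewrite groupM.
  by rewrite permM tE mul1r subrr s0.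
rewrite -(map_inj_uniq (@perm_inj _ q)) /= qx !inE.
case qy: (q y) => [u|]; last by rewrite eqxx.
case qw: (q w) => [v|]; last by rewrite eqxx orbT.
rewrite /= andbT => uv.
have vu0 : v - u != 0 by rewrite subr_eq0; apply: contraNneq uv => ->.
have vuV0 : (v - u)^-1 != 0 by rewrite invr_eq0.
have [t [tG tN tE]] := affine_exists (- (u / (v - u))) vuV0.
exists (q * t)%g; rewrite groupM ?permM // qx qy qw tN !tE; split=> //.
  by congr Some; field.
by congr Some; field.
Qed.

Definition base_triple : 3.-tuple (option F) := [tuple None; Some 0; Some 1].

Lemma base_triple_uniq : uniq base_triple.
Proof. by rewrite /= !inE /= (inj_eq Some_inj) eq_sym oner_eq0. Qed.

Lemma mobius_transitive3 : [transitive^3 G, on setT | 'P].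
Proof.
have b3 : base_triple \in 3.-dtuple([set: option F]).
  by rewrite inE base_triple_uniq; apply/subsetP.
apply/imsetP; exists base_triple => //; apply/setP=> t.
apply/idP/imsetP; last first.
  case=> g gG ->; apply: n_act_dtuple => //.
  by apply/astabsP=> x; rewrite !inE.
rewrite inE => /andP[]; case: t => -[|x [|y [|w []]]] //= sz u _.
have [p [pG px py pw]] := mobius_to_base u.
exists p^-1%g; rewrite ?groupV //; apply: val_inj => /=.
by rewrite -px -py -pw /= !(actK 'P%act).
Qed.

(** Conjugation moves t to the triple (oo, 0, 1). *)
Lemma mobius_free3 (t : 3.-tuple (option F)) : uniq t ->
  {in G, forall p, n_act 'P t p = t -> p = 1%g}.
Proof.
case: t => -[|x [|y [|w []]]] //= sz u p pG /(congr1 val) [px py pw].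
have [h [hG hx hy hw]] := mobius_to_base u.
apply: (conjg_inj h); rewrite conj1g; apply: mobius_fix3.
- by rewrite groupJ.
- by rewrite -hx permJ -/(aperm x p) px.
- by rewrite -hy permJ -/(aperm y p) py.
- by rewrite -hw permJ -/(aperm w p) pw.
Qed.

(** The divisibility-free form of lambda = k(k-1)(k-2) / |G_B|. *)
Lemma orbit_is_design (B : {set option F}) k lambda : #|B| = k ->
  is_design 3 k lambda (set_orbit G B) =
  (lambda * #|set_stabiliser G B| == k ^_ 3)%N.
Proof.
move=> Bk.
have cnt (T : {set option F}) : #|T| = 3%N ->
    (#|[set A in set_orbit G B | T \subset A]| * #|set_stabiliser G B|
      = k ^_ 3)%N.
  move=> T3; rewrite card_orbit_containing.
  have sT : size (enum T) == 3 by rewrite -cardE T3.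
  have uT : uniq (Tuple sT) by apply: enum_uniq.
  have <- : [set x in Tuple sT] = T by apply/setP=> x; rewrite inE mem_enum.
  have free_T := mobius_free3 uT.
  by rewrite (card_sharply_transitive _ mobius_transitive3 free_T) ?Bk.
apply/idP/idP.
  case/andP=> _ /forall_inP des.
  (* The value of lambda can be read off any single 3-subset. *)
  have T3 : #|[set x in base_triple]| == 3%N.
    by rewrite cardsE (card_uniqP base_triple_uniq).
  by rewrite -(eqP (des _ T3)) cnt //; apply/eqP.
move=> /eqP e; apply/andP; split.
  by apply/forall_inP=> _ /imsetP[g _ ->]; rewrite card_setact Bk.
apply/forall_inP=> T /eqP /cnt; rewrite -e => /eqP.
by rewrite eqn_pmul2r // cardG_gt0.
Qed.

End MobiusGroup.

(** * The block {oo, 0} together with the m-th roots of unity *)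

Lemma prime_order_primitive_root (R : nzRingType) m (a : R) :
  prime m -> a ^+ m = 1 -> a != 1 -> m.-primitive_root a.
Proof.
move=> prm am a1; have [k prk km] := prim_order_exists (prime_gt0 prm) am.
case/primeP: prm => _ /(_ _ km) /pred2P[k1 | <- //].
by have := prim_expr_order prk; rewrite k1 expr1 => /eqP; rewrite (negPf a1).
Qed.

Section BaseBlock.
Variable F : finFieldType.
Implicit Types (a b z : F) (m : nat) (B : {set option F}) (p : {perm option F}).
Local Notation G := (mobius_group F).

Definition base_block m : {set option F} :=
  [set x | if x is Some z then (z == 0) || (z ^+ m == 1) else true].

Lemma card_roots_of_unity m z : m.-primitive_root z ->
  #|[set w : F | w ^+ m == 1]| = m.
Proof.
move=> prz.
have inj : injective (fun i : 'I_m => z ^+ i).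
  move=> i j /eqP; rewrite (eq_prim_root_expr prz) !modn_small // => /eqP.
  exact: val_inj.
rewrite -[RHS]card_ord -cardsT -(card_imset _ inj); apply: eq_card => w.
rewrite inE; apply/eqP/imsetP => [/(prim_rootP prz)[i ->] | [i _ ->]].
  by exists i.
by rewrite exprAC (prim_expr_order prz) expr1n.
Qed.

Lemma card_base_block m z : m.-primitive_root z -> #|base_block m| = m.+2.
Proof.
move=> prz; have m0 := prim_order_gt0 prz.
have -> : base_block m =
    None |: (Some 0 |: Some @: [set w : F | w ^+ m == 1]).
  apply/setP=> -[w|]; rewrite !inE //= (inj_eq Some_inj).
  by rewrite (mem_imset _ _ Some_inj) inE.
have S0 : Some 0 \notin Some @: [set w : F | w ^+ m == 1].
  by rewrite (mem_imset _ _ Some_inj) inE expr0n gtn_eqF // eq_sym oner_eq0.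
rewrite !cardsU1 S0 (card_imset _ Some_inj) (card_roots_of_unity prz).
by rewrite !inE negb_or /=; case: imsetP => [[]|].
Qed.

Lemma scaling_stabilises_base_block m a : a != 0 -> a ^+ m = 1 ->
  exists p, [/\ p \in set_stabiliser G (base_block m), p None = None &
                forall z, p (Some z) = Some (a * z)].
Proof.
move=> a0 am; have [p [pG pN pE]] := affine_exists 0 a0.
exists p; split=> // [|z]; last by rewrite pE addr0.
apply: mem_set_stabiliser => // -[z|]; last by rewrite pN inE.
by rewrite pE addr0 !inE mulf_eq0 (negPf a0) exprMn am mul1r.
Qed.

Lemma inversion_stabilises_base_block m :
  exists p, [/\ p \in set_stabiliser G (base_block m), p None = Some 0,
                p (Some 0) = None & (p * p = 1)%g].
Proof.
have [p [pG pN p0 pE]] := inversion_exists F.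
exists p; split=> //.
  apply: mem_set_stabiliser => // -[z|]; last by rewrite pN !inE eqxx.
  rewrite !inE; case: eqVneq => [-> | z0 /= zm]; first by rewrite p0.
  by rewrite pE // exprVn (eqP zm) invr1 eqxx orbT.
apply/permP => -[z|]; rewrite permM perm1 ?pN //.
by case: (eqVneq z 0) => [-> | z0]; rewrite ?p0 // !pE ?invrK // invr_eq0.
Qed.

(** Here g is a scaling by some a of order m, and the orbit of 1 under g is
    the set of powers of a; together with oo and 0 it already has m + 2
    points. *)
Lemma two_fixed_points_block m g (prm : prime m) B :
    g \in set_stabiliser G B -> #[g]%g = m -> #|B| = m.+2 ->
    g None = None -> g (Some 0) = Some 0 ->
    None \in B -> Some 0 \in B -> Some 1 \in B ->
  B = base_block m /\ exists z : F, m.-primitive_root z.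
Proof.
move=> gH og Bm gN g0 NB B0 B1; have gG := subsetP (subsetIl _ _) _ gH.
have [a a0 gE] := fix_infinity_zero_scaling gG gN g0.
have gX i z : (g ^+ i)%g (Some z) = Some (a ^+ i * z).
  elim: i => [|i IH]; first by rewrite perm1 mul1r.
  by rewrite expgSr permM IH gE mulrA -exprS.
have am : a ^+ m = 1.
  by have := gX m 1; rewrite -og expg_order perm1 og mulr1 => -[<-].
have a1 : a != 1.
  apply: contraTneq prm => a1; have g1 : g = 1%g.
    by apply: mobius_fix3 => //; rewrite gE a1 mul1r.
  by rewrite -og g1 order1.
have pra := prime_order_primitive_root prm am a1.
split; last by exists a.
apply/esym/eqP; rewrite eqEcard (card_base_block pra) Bm leqnn andbT.
apply/subsetP=> -[z|] //; rewrite inE => /orP[/eqP-> // | /eqP].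
move=> /(prim_rootP pra)[i ->]; rewrite -[_ ^+ i]mulr1 -gX.
exact: set_stabiliser_mem (groupX i gH) B1.
Qed.

Lemma set_orbit_act B p : p \in G ->
  set_orbit G (('P^* )%act B p) = set_orbit G B.
Proof. exact: orbit_act. Qed.

Lemma card_set_stabiliser_act B p : p \in G ->
  #|set_stabiliser G (('P^* )%act B p)| = #|set_stabiliser G B|.
Proof.
move=> pG; apply/eqP; rewrite -(eqn_pmul2l (m := #|set_orbit G B|)).
  by rewrite -{1}(set_orbit_act B pG) !card_orbit_stab.
by apply/card_gt0P; exists B; apply: orbit_refl.
Qed.

(** An element g of order m in the stabiliser has cycles of length 1 and m, and
    m + 2 is congruent to 2 modulo m, so g has at least two fixed points in B.
    The condition 2 < m excludes 2 = 0 modulo m and leaves a third point of B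
    to be sent to 1. *)
Lemma prime_stabiliser_base_block m B : prime m -> (2 < m)%N -> #|B| = m.+2 ->
    (m %| #|set_stabiliser G B|)%N ->
  (exists2 p, p \in G & ('P^* )%act B p = base_block m) /\
  exists z : F, m.-primitive_root z.
Proof.
move=> prm m2 Bm mH.
have [g gH og] := Cauchy prm mH; have gG := subsetP (subsetIl _ _) _ gH.
have : (1 < #|'Fix_(B | 'P)(<[g]>)%g|)%N.
  have mg : (m.-group <[g]>)%g by rewrite /pgroup -orderE og pnat_id.
  have gB : [acts <[g]>, on B | 'P]%g.
    by rewrite cycle_subG (subsetP (set_stabiliser_acts G B)).
  have := pgroup_fix_mod mg gB; rewrite Bm -addn2 modnDl (modn_small m2).
  by case: #|_| => [|[|?]] //; rewrite ?mod0n // modn_small // prime_gt1.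
move=> /card_gt1P[x [y [xF yF xy]]].
have xB : x \in B by case/setIP: xF.
have yB : y \in B by case/setIP: yF.
have gx : g x = x by case/setIP: xF => _ /afixP/(_ g (cycle_id g)).
have gy : g y = y by case/setIP: yF => _ /afixP/(_ g (cycle_id g)).
have /card_gt0P[w] : (0 < #|B :\: [set x; y]|)%N.
  rewrite cardsD subn_gt0.
  apply: leq_ltn_trans (subset_leq_card (subsetIr _ _)) _.
  by rewrite cards2 xy Bm !ltnS prime_gt0.
rewrite !inE negb_or => /andP[/andP[wx wy] wB].
have [|h [hG hx hy hw]] := @mobius_to_base _ x y w.
  by rewrite /= !inE negb_or xy ![_ == w]eq_sym wx wy.
have hB v : v \in B -> h v \in ('P^* )%act B h by apply: mem_setact.
have [] := @two_fixed_points_block m (g ^ h)%g prm (('P^* )%act B h).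
- apply: mem_set_stabiliser; first by rewrite groupJ.
  move=> _ /imsetP[v vB ->]; rewrite /aperm permJ hB //.
  exact: set_stabiliser_mem gH vB.
- by rewrite orderJ.
- by rewrite card_setact.
- by rewrite -hx permJ gx.
- by rewrite -hy permJ gy.
- by rewrite -hx hB.
- by rewrite -hy hB.
- by rewrite -hw hB.
by move=> <- ex; split=> //; exists h.
Qed.

(** * The stabiliser of the block for m = 11 in characteristic 2 *)

Hypothesis pchar2 : 2 \in [pchar F].

(** In characteristic 2, the twelfth power of 1 + z is (1 + z^8)(1 + z^4),
    while by hypothesis it is 1 + z.  Since z^12 = z this leaves z^8 = z^4, and
    z^4 = 1 forces z = z^12 = 1. *)
Lemma unity_root11_succ z : z ^+ 11 = 1 -> (1 + z) ^+ 11 = 1 -> z = 1.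
Proof.
move=> z11 sz11.
have frob n : (1 + z) ^+ (2 ^ n) = 1 + z ^+ (2 ^ n).
  by rewrite exprDn_pchar ?expr1n // pnatX pnatE // pchar2.
have e12 : (1 + z ^+ 8) * (1 + z ^+ 4) = 1 + z.
  by rewrite -(frob 3) -(frob 2) -exprD exprS sz11 mulr1.
have z12 : z ^+ 12 = z by rewrite exprS z11 mulr1.
have e84 : z ^+ 8 + z ^+ 4 = 0.
  apply: (addrI (1 + z)); rewrite addr0 -[RHS]e12 -[X in 1 + X + _]z12; ring.
have z0 : z != 0.
  by apply: contra_eq_neq z11 => ->; rewrite expr0n eq_sym oner_eq0.
have z4 : z ^+ 4 = 1.
  apply: (mulIf (expf_neq0 4 z0)); rewrite mul1r -exprD.
  by apply/eqP; rewrite -subr_eq0 (GRing.subr_pchar2 pchar2) e84.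
by rewrite -z12 (exprM z 4 3) z4 expr1n.
Qed.

(** An affine involution z |-> a z + b satisfies a^2 = 1, so it is a translation
    in characteristic 2.  It maps 0 and b z to the points b and b (1 + z) of the
    block, so for nonzero b both b and 1 + z are 11th roots of unity; by
    [unity_root11_succ] this cannot happen for z <> 1. *)
Lemma base_block11_no_involution z p : 11.-primitive_root z ->
  p \in set_stabiliser G (base_block 11) -> p None = None -> (p * p = 1)%g ->
  p = 1%g.
Proof.
move=> prz pH pN pp; have pG := subsetP (subsetIl _ _) _ pH.
have [a [b [a0 pE]]] := fix_infinity_affine pG pN.
have ppE u : a * (a * u + b) + b = u.
  by have := permM p p (Some u); rewrite pp perm1 !pE => -[<-].
have a1 : a = 1.
  have : a ^+ 2 = 1.
    (* Comparing the square of p at 1 and at 0 eliminates b. *)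
    have -> : a ^+ 2 = (a * (a * 1 + b) + b) - (a * (a * 0 + b) + b) by ring.
    by rewrite !ppE subr0.
  by move/eqP; rewrite sqrf_eq1 (oppr_pchar2 pchar2) orbb => /eqP.
have [b0|b0] := eqVneq b 0.
  by apply: mobius_fix3; rewrite // pE a1 b0 mul1r addr0.
have pB u : Some u \in base_block 11 -> Some (u + b) \in base_block 11.
  by move=> uB; rewrite -[u]mul1r -a1 -pE; exact: set_stabiliser_mem pH uB.
have b11 : b ^+ 11 = 1.
  have := pB 0; rewrite !inE eqxx add0r (negPf b0) /= => /(_ isT).
  by move/eqP.
have z11 := prim_expr_order prz.
have z1 : z != 1.
  by rewrite -[z]expr1 -(prim_order_dvd prz).
have := pB (b * z); rewrite !inE exprMn b11 z11 mul1r eqxx orbT => /(_ isT).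
have -> : b * z + b = b * (1 + z) by ring.
have sz0 : 1 + z != 0.
  by rewrite -(GRing.subr_pchar2 pchar2) subr_eq0 eq_sym.
rewrite mulf_eq0 (negPf b0) (negPf sz0) exprMn b11 mul1r /= => /eqP.
by move=> /(unity_root11_succ z11) zz; rewrite zz eqxx in z1.
Qed.

(** Under the hypothesis the elements fixing oo are scalings z |-> c z, and c is
    the image of 1, which must be an m-th root of unity. *)
Lemma card_stabiliser_infinity m z : m.-primitive_root z ->
  (forall p, p \in set_stabiliser G (base_block m) ->
    p None = None -> p (Some 0) = Some 0) ->
  #|'C_(set_stabiliser G (base_block m))[None | 'P]%g| = m.
Proof.
move=> prz fix0; set K := 'C_(_)[_ | _]%g.
have KP p : p \in K ->
    [/\ p \in set_stabiliser G (base_block m), p \in G & p None = None].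
  case/setIP=> pH /astab1P pN; split=> //.
  exact: subsetP (subsetIl _ _) _ pH.
have inj : {in K &, injective (fun p => p (Some 1))}.
  move=> p q /KP[pH pG pN] /KP[qH qG qN] e.
  have p0 := fix0 _ pH pN; have q0 := fix0 _ qH qN.
  have [c c0 pE] := fix_infinity_zero_scaling pG pN p0.
  have [d d0 qE] := fix_infinity_zero_scaling qG qN q0.
  move: e; rewrite pE qE !mulr1 => -[cd].
  by apply/permP=> -[u|]; rewrite ?pN ?qN // pE qE cd.
rewrite -[RHS](card_roots_of_unity prz) -[RHS](card_imset _ Some_inj).
rewrite -(card_in_imset inj); apply: eq_card => x.
apply/imsetP/imsetP => [[p /KP[pH pG pN] ->] | [w]].
  have [c c0 pE] := fix_infinity_zero_scaling pG pN (fix0 _ pH pN).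
  exists c; last by rewrite pE mulr1.
  have := set_stabiliser_mem pH (x := Some 1).
  by rewrite pE mulr1 !inE expr1n eqxx orbT (negPf c0) => /(_ isT).
rewrite inE => /eqP wm ->.
have w0 : w != 0.
  apply: contra_eq_neq wm => ->.
  by rewrite expr0n gtn_eqF ?(prim_order_gt0 prz) // eq_sym oner_eq0.
have [p [pH pN pE]] := scaling_stabilises_base_block w0 wm.
by exists p; rewrite ?pE ?mulr1 // inE pH; apply/astab1P.
Qed.

(** The inversion gives oo and 0 the same orbit.  If this orbit contained one
    root of unity, it would contain them all and have 13 points; the stabiliser
    of oo would then have even order and contain an involution. *)
Lemma card_set_stabiliser_base_block11 z : 11.-primitive_root z ->
  #|set_stabiliser G (base_block 11)| = 22%N.
Proof.
move=> prz; set H := set_stabiliser G _.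
have [s [sH sN s0 ss]] := inversion_stabilises_base_block 11.
have H2 : (2 %| #|H|)%N.
  have s1 : s != 1%g by apply: contra_eq_neq sN => ->; rewrite perm1.
  by rewrite -(nt_prime_order (isT : prime 2) _ s1) ?order_dvdG.
have orbB : orbit 'P%act H None \subset base_block 11.
  apply/subsetP=> _ /imsetP[p pH ->].
  by apply: (set_stabiliser_mem pH); rewrite inE.
have orb : orbit 'P%act H None = [set None; Some 0].
  apply/eqP; rewrite eqEsubset andbC subUset !sub1set orbit_refl.
  rewrite -{1}sN (mem_orbit 'P%act) //=.
  apply/subsetP=> x xO; apply: contraLR H2 => xN.
  case: x xO xN => [x|] xO; rewrite !inE //= (inj_eq Some_inj) => x0.
  have := subsetP orbB _ xO; rewrite inE (negPf x0) /= => /eqP x11.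
  have {orbB}orbE : orbit 'P%act H None = base_block 11.
    apply/eqP; rewrite eqEsubset orbB; apply/subsetP=> -[u|]; last first.
      by rewrite orbit_refl.
    rewrite inE; case: (eqVneq u 0) => [-> _ | u0 /= /eqP u11].
      by rewrite -sN (mem_orbit 'P%act).
    have ux0 : u / x != 0 by rewrite mulf_neq0 ?invr_eq0.
    have ux11 : (u / x) ^+ 11 = 1 by rewrite expr_div_n u11 x11 divr1.
    have [p [pH pN pE]] := scaling_stabilises_base_block ux0 ux11.
    have <- : p (Some x) = Some u by rewrite pE divfK.
    by have <- := orbit_eqP xO; rewrite (mem_orbit 'P%act).
  rewrite -(card_orbit_stab 'P%act H None) orbE (card_base_block prz).
  rewrite Euclid_dvdM //=; apply/negP => K2.
  have [p /setIP[pH /astab1P pN] op] := Cauchy (isT : prime 2) K2.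
  have pp : (p * p = 1)%g by rewrite -[LHS]/(p ^+ 2)%g -op expg_order.
  by move: op; rewrite (base_block11_no_involution prz pH pN pp) order1.
rewrite -(card_orbit_stab 'P%act H None) orb cards2.
rewrite (card_stabiliser_infinity prz) //.
move=> p pH pN; have : p (Some 0) \in orbit 'P%act H None.
  rewrite -sN; apply/imsetP; exists (s * p)%g; first by rewrite groupM.
  by rewrite /= /aperm permM.
rewrite orb !inE -{1}pN (inj_eq perm_inj) /=; exact/eqP.
Qed.

End BaseBlock.

(** * Existence of primitive 11th roots of unity, and the theorem *)

Local Close Scope ring_scope.

(** 2 has multiplicative order 10 modulo 11: the power 2^10 is 1, and the
    remaining exponents are below 10 and checked one by one. *)
Lemma dvdn11_pow2_pred n : (11 %| (2 ^ n).-1) = (10 %| n).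
Proof.
rewrite -subn1 -eqn_mod_dvd ?expn_gt0 // {1}(divn_eq n 10) expnD.
rewrite [_ * 10]mulnC expnM.
rewrite -modnMml -modnXm -[2 ^ 10 %% 11]/1 exp1n.
rewrite /dvdn; have : n %% 10 < 10 by rewrite ltn_mod.
by move: (n %% 10); do 10?case=> //.
Qed.

Lemma primitive_root11_iff n (F : finFieldType) : #|F| = 2 ^ n ->
  (exists z : F, (11.-primitive_root z)%R) <-> 10 %| n.
Proof.
move=> cardF; rewrite -dvdn11_pow2_pred -cardF; split.
  case=> z prz; rewrite (prim_order_dvd prz).
  have z0 : (z != 0)%R by rewrite (prim_root_eq0 prz).
  apply/eqP/(mulfI z0); rewrite -exprS prednK ?expf_card ?mulr1 //.
  by apply/card_gt0P; exists 0%R.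
rewrite -card_finField_unit => /(Cauchy (isT : prime 11))[u _ ou].
exists (val u); apply: prime_order_primitive_root => //.
  by rewrite -FinRing.val_unitX -ou expg_order.
apply: contra_eq_neq ou => u1; rewrite (_ : u = 1%g) ?order1 //.
  exact: val_inj.
Qed.

Theorem proposition3p2 (n : nat) (n_ge1 : 1 <= n)
    (F : finFieldType) (cardF : #|F| = 2 ^ n) :
  (forall B : {set option F}, #|B| = 13 ->
     11 %| #|set_stabiliser (mobius_group F) B| ->
     #|set_stabiliser (mobius_group F) B| = 22) /\
  num_design_orbits (mobius_group F) 3 13 78 = (if 10 %| n then 1 else 0).
Proof.
have pchar2 : 2 \in [pchar F]%R := card_finPcharP cardF isT.
have base (B : {set option F}) :
    #|B| = 13 -> 11 %| #|set_stabiliser (mobius_group F) B| ->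
    [/\ 10 %| n, #|set_stabiliser (mobius_group F) B| = 22 &
        set_orbit (mobius_group F) B =
        set_orbit (mobius_group F) (base_block F 11)].
  move=> B13 dv; have [[p pG pB] ex] :=
    prime_stabiliser_base_block (isT : prime 11) isT B13 dv.
  split; first exact/(primitive_root11_iff cardF).
    case: ex => z prz.
    rewrite -(card_set_stabiliser_act B pG) pB.
    by rewrite (card_set_stabiliser_base_block11 pchar2 prz).
  by rewrite -(set_orbit_act B pG) pB.
split=> [B B13 /(base B B13)[] // |]; rewrite /num_design_orbits.
have des (B : {set option F}) : #|B| = 13 ->
    is_design 3 13 78 (set_orbit (mobius_group F) B) =
    (#|set_stabiliser (mobius_group F) B| == 22).
  move=> B13; rewrite (orbit_is_design _ B13).
  by rewrite -[RHS](eqn_pmul2l (isT : 0 < 78)).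
case: ifPn => [n10 | n10].
  have [z prz] := (primitive_root11_iff cardF).2 n10.
  have B13 := card_base_block prz.
  apply/eqP/cards1P; exists (set_orbit (mobius_group F) (base_block F 11)).
  apply/setP=> O; rewrite !inE; apply/andP/eqP => [[/imsetP[B]] | ->].
    rewrite inE => /eqP cB ->; rewrite des // => /eqP B22.
    by have [|_ _ ->] := base B cB; rewrite ?B22.
  split; first by apply/imsetP; exists (base_block F 11); rewrite // inE B13.
  by rewrite des // (card_set_stabiliser_base_block11 pchar2 prz).
apply: eq_card0 => O; rewrite !inE; apply/andP=> -[/imsetP[B]].
rewrite inE => /eqP cB ->; rewrite des // => /eqP B22.
by have [|//] := base B cB; [rewrite B22 | rewrite (negPf n10)].
Qed.
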